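(* Let $n\ge1$ and $\bm{N}=(N_0,\ldots,N_{n-1},-\sum_{i<n}N_i)\in\mathbb{Z}^{n+1}$ (entries not necessarily nonnegative). Let $s_k=\sum_{j=0}^kN_j$ and, for $1\le k\le n$, $c_k=\frac{N_{n-k}}{k+1}+\frac{s_{n-k}}{k(k+1)}$. (1) If $s_k\ge\max\{0,-(n-k)N_k\}$ for all $k\in\{0,\ldots,n-1\}$, then \[ K_n(\bm{N})\ge\frac1{n^2}\prod_{k=0}^{n-1}\frac{s_k^{s_k}}{(1+s_k)^{1+s_k}}\prod_{k=1}^n\Big(\frac{(c_k+1)^{c_k+1}}{c_k^{c_k}}\Big)^k. \] (2) If $s_k\ge\max\{0,-(n-k)N_k\}$ and $N_k\ge\frac1{n-k}-(n-k+1)$ for all $k\in\{0,\ldots,n-1\}$, then \[ K_n(\bm{N})\ge\frac{1}{n^2e^n(n!)^2}\prod_{k=1}^n\Big(\frac{(c_k+1)^{c_k+1}}{c_k^{c_k}}\Big)^{k-1}. \]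
   Context: $K_n(\bm{N})$ is the number of integer vectors $(f_{ij})_{0\le i<j\le n}\in\mathbb{Z}_{\ge0}^{\binom{n+1}{2}}$ with $\sum_{j>i} f_{ij}-\sum_{k<i} f_{ki}=N_i$ for every $i\in\{0,\ldots,n\}$. Convention $0^0=1$. *)

(* Defs.v *)
From HB Require Import structures.
From mathcomp Require Import all_boot all_order all_algebra.
From mathcomp Require Import all_classical all_reals all_analysis.
Set Implicit Arguments. Unset Strict Implicit. Unset Printing Implicit Defensive.
Import Order.TTheory GRing.Theory Num.Theory.
Local Open Scope ring_scope.

Definition Nvec (n : nat) (N : nat -> int) (i : nat) : int :=
  if (i < n)%N then N i else - (\sum_(j < n) N j).

Definition spart (N : nat -> int) (k : nat) : int := \sum_(j < k.+1) N j.

Definition cK (R : realType) (n : nat) (N : nat -> int) (k : nat) : R :=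
  (N (n - k)%N)%:~R / (k.+1)%:R + (spart N (n - k)%N)%:~R / (k * k.+1)%:R.

(* Bound on entries of any solution: each f_ij <= s_i <= sum_i |N_i|
   (the flow across the cut {0..i} | {i+1..n} equals s_i). *)
Definition Kbound (n : nat) (N : nat -> int) : nat :=
  (\sum_(i < n.+1) `|Nvec n N i|)%N.

(* f : pairs (i,j) of {0..n}^2, required to vanish unless i < j, encodes the
   vector (f_ij)_{0<=i<j<=n}. Net flow condition at every vertex i. *)
Definition is_Kflow (n : nat) (N : nat -> int) (B : nat)
    (f : {ffun 'I_n.+1 * 'I_n.+1 -> 'I_B.+1}) : bool :=
  [forall p : 'I_n.+1 * 'I_n.+1, (p.2 <= p.1)%N ==> (val (f p) == 0%N)] &&
  [forall i : 'I_n.+1,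
     ((\sum_(j : 'I_n.+1 | (i < j)%N) val (f (i, j)))%:Z
      - (\sum_(k : 'I_n.+1 | (k < i)%N) val (f (k, i)))%:Z
      == Nvec n N i)].

Definition Kost (n : nat) (N : nat -> int) : nat :=
  #|[set f : {ffun 'I_n.+1 * 'I_n.+1 -> 'I_(Kbound n N).+1} | @is_Kflow n N _ f]|.

(* Main.v *)
(* Build flows vertex by vertex. In a partial flow on the vertices below [j], the inflows pending at
   the vertices [j, ..., n] are exchangeable and add up to [s_(j-1)], so the
   pending inflow at [j] has mean [s_(j-1) / (k+1)] with [k = n - j]; hence
   vertex [j] has to send out [k c_k] on average. The number of ways to
   distribute [x] among [k] targets is a convex function of [x] when [k >= 2],
   and Jensen's inequality bounds the number of extensions from below by its
   value at [k c_k], which is at least [G(c_k)^k / G(k c_k)] for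
   [G(c) = (c+1)^(c+1) / c^c], and [k c_k <= s_j]. For [k = 1] exchangeability
   still gives that at least half of the partial flows extend. This proves (1)
   with [1/2] instead of [1/n^2] when [n > 1]; (2) follows from (1) by bounding
   [G(s_j) / G(c_k)]. *)
Require Import Defs.
From HB Require Import structures.
From mathcomp Require Import all_boot all_order all_algebra.
From mathcomp Require Import all_classical all_reals all_analysis.
From mathcomp Require Import perm zify ring lra.
Import Order.TTheory GRing.Theory Num.Theory.
Local Open Scope ring_scope.

(** * Entropy inequalities *)

(* The entropy of the geometric distribution of mean [c]; the value at [c = 0]
   is [0] because [ln 0 = 0] in the library. *)
Definition geom_entropy {R : realType} (c : R) : R :=
  (c + 1) * ln (c + 1) - c * ln c.

Lemma expR_geom_entropy {R : realType} {c : R} : 0 <= c ->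
  expR (geom_entropy c) = (c + 1) `^ (c + 1) / c `^ c.
Proof.
rewrite le_eqVlt => /predU1P[<-|c0].
  by rewrite /geom_entropy mul0r subr0 add0r ln1 mulr0 expR0 powRr0 powRr1 ?divr1.
have c10 : 0 < c + 1 by rewrite addr_gt0.
by rewrite /powR (gt_eqF c0) (gt_eqF c10) -expRN -expRD.
Qed.

Lemma ln_ratio_le {R : realType} {a b : R} : 0 < a -> 0 < b ->
  ln a - ln b <= a / b - 1.
Proof.
move=> a0 b0; rewrite -ln_div ?posrE//.
have := @le_ln1Dx R (a / b - 1).
rewrite addrCA subrr addr0; apply.
have : 0 < a / b by rewrite divr_gt0.
lra.
Qed.

Lemma geom_entropy_ge0 {R : realType} {c : R} : 0 <= c -> 0 <= geom_entropy c.
Proof.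
rewrite le_eqVlt => /predU1P[<-|c0].
  by rewrite /geom_entropy mul0r subr0 add0r ln1 mulr0.
have l0 : 0 <= ln (c + 1) by rewrite ln_ge0// lerDr ltW.
have : ln c <= ln (c + 1) by rewrite ler_ln ?posrE ?lerDl// addr_gt0.
rewrite /geom_entropy; nra.
Qed.

(** Gibbs' inequality between the geometric distributions of means [x] and [s] gives the bound
    [(x + 1) * ln (s + 1) - x * ln s], which grows with [x] up to its value at [x = s]. It comes
    from two uses of [ln_ratio_le] with weights [x] and 1, whose right-hand sides cancel. *)
Lemma geom_entropy_mono {R : realType} {x s : R} : 0 <= x -> x <= s ->
  geom_entropy x <= geom_entropy s.
Proof.
rewrite le_eqVlt => /predU1P[<- s0|x0 xs].
  by rewrite {1}/geom_entropy mul0r subr0 add0r ln1 mulr0 geom_entropy_ge0.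
have s0 : 0 < s by exact: lt_le_trans xs.
have x10 : 0 < x + 1 by rewrite addr_gt0.
have s10 : 0 < s + 1 by rewrite addr_gt0.
have H1 := ln_ratio_le (mulr_gt0 s0 x10) (mulr_gt0 x0 s10).
have H2 := ln_ratio_le x10 s10.
have H3 : ln s <= ln (s + 1) by rewrite ler_ln ?posrE ?lerDl.
move: H1; rewrite !lnM ?posrE// => H1.
have H : x * (s * (x + 1) / (x * (s + 1)) - 1) + ((x + 1) / (s + 1) - 1) = 0.
  by field; rewrite !gt_eqF.
rewrite /geom_entropy.
have : x * (ln s + ln (x + 1) - (ln x + ln (s + 1))) <=
   x * (s * (x + 1) / (x * (s + 1)) - 1) by rewrite ler_pM2l.
nra.
Qed.

(** Two uses of [ln_ratio_le] with weights [t + 1] and [u - t] have cancelling right-hand sides.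
    This drives the induction in [binpoly_entropy]. *)
Lemma ln_succ_ratio_anti {R : realType} {t u : R} : 0 < t -> t <= u ->
  (u + 1) * (ln (u + 1) - ln u) <= (t + 1) * (ln (t + 1) - ln t).
Proof.
move=> t0 tu.
have u0 : 0 < u by exact: lt_le_trans tu.
have t10 : 0 < t + 1 by rewrite addr_gt0.
have u10 : 0 < u + 1 by rewrite addr_gt0.
have H1 := ln_ratio_le (mulr_gt0 t0 u10) (mulr_gt0 t10 u0).
have H2 := ln_ratio_le u10 u0.
move: H1; rewrite !lnM ?posrE// => H1.
have H : (t + 1) * (t * (u + 1) / ((t + 1) * u) - 1)
   + (u - t) * ((u + 1) / u - 1) = 0.
  by field; rewrite !gt_eqF.
have : (t + 1) * (ln t + ln (u + 1) - (ln (t + 1) + ln u)) <=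
   (t + 1) * (t * (u + 1) / ((t + 1) * u) - 1) by rewrite ler_pM2l.
have : (u - t) * (ln (u + 1) - ln u) <= (u - t) * ((u + 1) / u - 1).
  by apply: ler_wpM2l; rewrite ?subr_ge0.
nra.
Qed.

(** * Composition counts: convexity and entropy bound *)

(* The polynomial in [x] whose value at a natural number [m] is the number of
   compositions of [m] into [k.+1] nonnegative parts. *)
Definition binpoly {R : realType} (k : nat) (x : R) : R :=
  \prod_(i < k) ((x + i.+1%:R) / i.+1%:R).

Lemma binpolyS {R : realType} k (x : R) :
  binpoly k.+1 x = binpoly k x * ((x + k.+1%:R) / k.+1%:R).
Proof. by rewrite /binpoly big_ord_recr. Qed.

Lemma binpoly0 {R : realType} (x : R) : binpoly 0 x = 1.
Proof. by rewrite /binpoly big_ord0. Qed.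

Lemma binpoly_gt0 {R : realType} k (x : R) : 0 <= x -> 0 < binpoly k x.
Proof.
move=> x0; apply: prodr_gt0 => i _.
by rewrite divr_gt0// ltr_wpDl.
Qed.

Lemma binpolyN1 {R : realType} k : binpoly k.+1 (-1) = 0 :> R.
Proof. by rewrite /binpoly big_ord_recl/= addNr !mul0r. Qed.

Lemma binpoly_nat {R : realType} k m : binpoly k m%:R = 'C(m + k, k)%:R :> R.
Proof.
elim: k => [|k IH]; first by rewrite binpoly0 bin0.
rewrite binpolyS IH.
have := mul_bin_diag (m + k).+1 k; rewrite addnS /= => E.
apply: (@mulIf _ k.+1%:R); first by rewrite pnatr_eq0.
rewrite -mulrA divfK ?pnatr_eq0// -natrD -!natrM.
by congr _%:R; rewrite [RHS]mulnC -E mulnC addnS.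
Qed.

(** Induction over the factors: for [y >= -1] each new factor is nonnegative, so the bound may be
    multiplied by it. The range reaches down to the root -1, and the slope is nonnegative, so that
    negative arguments can be handled later. *)
Lemma binpoly_lower_tangent {R : realType} k {x : R} : 0 <= x ->
  exists2 D, 0 <= D &
    forall y, -1 <= y -> binpoly k x + D * (y - x) <= binpoly k y.
Proof.
move=> x0; elim: k => [|k [D D0 IH]].
  by exists 0 => // y _; rewrite !binpoly0 mul0r addr0.
have K0 : 0 < k.+1%:R :> R by [].
(* The slope is given by the product rule; multiplying the hypothesis by [y + K] leaves the surplus
   [D * (y - x) ^+ 2]. *)
exists ((D * (x + k.+1%:R) + binpoly k x) / k.+1%:R).
  rewrite divr_ge0// addr_ge0 ?mulr_ge0 ?addr_ge0//.
  by rewrite ltW// binpoly_gt0.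
move=> y y1; rewrite !binpolyS.
have := IH y y1.
have : 1 <= k.+1%:R :> R by rewrite ler1n.
set K : R := k.+1%:R; set p := binpoly k x; set q := binpoly k y => K1 Hpq.
rewrite -(ler_pM2r K0) -/K.
have -> : (p * ((x + K) / K) + (D * (x + K) + p) / K * (y - x)) * K
  = p * (x + K) + (D * (x + K) + p) * (y - x) by field; rewrite gt_eqF.
rewrite -mulrA divfK ?gt_eqF//.
have : (p + D * (y - x)) * (y + K) <= q * (y + K).
  by apply: ler_wpM2r => //; lra.
have : 0 <= D * (y - x) ^+ 2 by rewrite mulr_ge0// sqr_ge0.
nra.
Qed.

Lemma binpoly_entropy {R : realType} {k} {x : R} : 0 <= x ->
  expR (k.+1%:R * geom_entropy (x / k.+1%:R) - geom_entropy x) <= binpoly k x.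
Proof.
move=> x0.
have -> : k.+1%:R * geom_entropy (x / k.+1%:R) - geom_entropy x =
  (x + k.+1%:R) * ln (x + k.+1%:R) - k.+1%:R * ln k.+1%:R
  - (x + 1) * ln (x + 1).
  have K0 : 0 < k.+1%:R :> R by [].
  move: k.+1%:R K0 => K K0.
  have Kn0 : K != 0 by rewrite gt_eqF.
  have -> : geom_entropy (x / K) = (x / K + 1) * (ln (x + K) - ln K) - x / K * ln (x / K).
    rewrite /geom_entropy -ln_div ?posrE// ?ltr_wpDl//; congr (_ * ln _ - _).
    by field.
  move: x0; rewrite le_eqVlt => /predU1P[<-|x0].
    rewrite /geom_entropy !mul0r !subr0 !add0r ln1; ring.
  by rewrite ln_div ?posrE// /geom_entropy; field.
(* Equality holds at [k = 0]. With [K = k.+1], the growth of the exponent is at most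
   [ln (x + K) - ln K] by [ln_succ_ratio_anti] at [K <= x + K]. *)
elim: k => [|k IH].
  by rewrite binpoly0 ln1 mulr0 subr0 subrr expR0.
rewrite binpolyS -(natr1 k.+1).
have : 0 < k.+1%:R :> R by [].
move: k.+1%:R IH => K IH K0.
have xK0 : 0 < x + K by rewrite ltr_wpDl.
have -> : (x + K) / K = expR (ln (x + K) - ln K).
  by rewrite -ln_div ?posrE// lnK// posrE divr_gt0.
apply: le_trans (ler_wpM2r (expR_ge0 _) IH).
rewrite -expRD ler_expR.
have := @ln_succ_ratio_anti R K (x + K) K0 _.
rewrite lerDr => /(_ x0).
rewrite (addrA x K 1); lra.
Qed.

(** * Partial flows and exchangeability of pending inflows *)

Local Notation flow n B := {ffun 'I_n.+1 * 'I_n.+1 -> 'I_B.+1}.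

Definition outflow {n B : nat} (f : flow n B)
  (i : 'I_n.+1) : nat := (\sum_m f (i, m))%N.

Definition inflow {n B : nat} (f : flow n B)
  (l : 'I_n.+1) : nat := (\sum_i f (i, l))%N.

(* Flows emitted by the vertices below [j] only: conservation is required there,
   and [inflow f l] for [j <= l] is what is pending at [l]. *)
Definition partial_flows (n : nat) (N : nat -> int) (B j : nat) :
    {set flow n B} :=
  [set f : flow n B | [forall p : 'I_n.+1 * 'I_n.+1,
              (j <= p.1)%N || (p.2 <= p.1)%N ==> (f p == 0%N :> nat)] &&
           [forall i : 'I_n.+1,
              (i < j)%N ==> ((outflow f i)%:Z - (inflow f i)%:Z == N i)]].

Lemma partial_flowsP {n} {N : nat -> int} {B j} {f : flow n B} :
  reflect ((forall i m : 'I_n.+1, (j <= i)%N || (m <= i)%N ->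
              f (i, m) = 0%N :> nat) /\
           (forall i : 'I_n.+1, (i < j)%N ->
              (outflow f i)%:Z - (inflow f i)%:Z = N i))
          (f \in partial_flows n N B j).
Proof.
rewrite inE; apply: (iffP andP) => -[H1 H2]; split.
- by move=> i m H; apply/eqP; move/forallP: H1 => /(_ (i, m)) /implyP; apply.
- by move=> i H; apply/eqP; move/forallP: H2 => /(_ i) /implyP; apply.
- by apply/forallP => -[i m]; apply/implyP => H; apply/eqP; exact: H1.
- by apply/forallP => i; apply/implyP => H; apply/eqP; exact: H2.
Qed.

(** Total outflow equals total inflow. Vertices from [j] on emit nothing, and those below [j] emit
    [N i] more than they receive, so this excess is what is pending. *)
Lemma sum_pending_inflow {n} {N : nat -> int} {B j} {f : flow n B} :
  (j <= n)%N -> f \in partial_flows n N B j ->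
  \sum_(l < n.+1 | (j <= l)%N) (inflow f l)%:Z = \sum_(i < j) N i.
Proof.
move=> jn /partial_flowsP[f0 fN].
have io : \sum_(i < n.+1) (outflow f i)%:Z = \sum_(i < n.+1) (inflow f i)%:Z.
  under eq_bigr do rewrite /outflow -natz natr_sum.
  under [RHS]eq_bigr do rewrite /inflow -natz natr_sum.
  exact: exchange_big.
have out0 : \sum_(i < n.+1 | ~~ (i < j)%N) (outflow f i)%:Z = 0.
  apply: big1 => i; rewrite -leqNgt => ji.
  by rewrite /outflow big1// => m _; rewrite f0 ?ji.
have -> : \sum_(i < j) N i = \sum_(i < n.+1 | (i < j)%N) N i.
  by rewrite (big_ord_widen n.+1 N)// ltnW.
rewrite -(eq_bigr _ fN) sumrB.
move: io; rewrite (bigID (fun i : 'I_n.+1 => (i < j)%N))/= out0 addr0 => ->.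
rewrite [X in _ = X - _](bigID (fun i : 'I_n.+1 => (i < j)%N))/= addrAC subrr add0r.
by apply: eq_bigl => i; rewrite -leqNgt.
Qed.

Definition swap_targets {n B : nat} (l m : 'I_n.+1)
    (f : flow n B) :=
  [ffun p : 'I_n.+1 * 'I_n.+1 => f (p.1, tperm l m p.2)].

Lemma swap_targetsK {n B : nat} (l m : 'I_n.+1) :
  involutive (@swap_targets n B l m).
Proof. by move=> f; apply/ffunP => -[i k]; rewrite !ffunE/= tpermK. Qed.

Lemma inflow_swap {n B : nat} (l m : 'I_n.+1)
    (f : flow n B) k :
  inflow (swap_targets l m f) k = inflow f (tperm l m k).
Proof. by apply: eq_bigr => i _; rewrite ffunE. Qed.

(** Both columns lie beyond every emitting vertex, so exchanging them keeps the zero pattern, all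
    outflows, and the inflows below [j]. *)
Lemma swap_partial_flows {n} {N : nat -> int} {B j} (l m : 'I_n.+1)
    (f : flow n B) :
  (j <= l)%N -> (j <= m)%N ->
  (swap_targets l m f \in partial_flows n N B j) = (f \in partial_flows n N B j).
Proof.
move=> jl jm.
have sub g : g \in partial_flows n N B j ->
    swap_targets l m g \in partial_flows n N B j.
  move=> /partial_flowsP[g0 gN]; apply/partial_flowsP; split.
    move=> i k; rewrite ffunE/=; case: (leqP j i) => [ji _|ij /= ki].
      by rewrite g0 ?ji.
    rewrite tpermD ?g0 ?ki ?orbT//.
      by apply: contraTneq jl => ->; rewrite -ltnNge (leq_ltn_trans ki).
    by apply: contraTneq jm => ->; rewrite -ltnNge (leq_ltn_trans ki).
  move=> i ij; rewrite inflow_swap tpermD.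
  - rewrite -gN//; congr (_%:Z - _).
    rewrite /outflow [RHS](reindex_inj (@perm_inj _ (tperm l m))).
    by apply: eq_bigr => k _; rewrite ffunE.
  - by apply: contraTneq jl => ->; rewrite -ltnNge.
  - by apply: contraTneq jm => ->; rewrite -ltnNge.
by apply/idP/idP => [/sub|/sub//]; rewrite swap_targetsK.
Qed.

Lemma sum_partial_flows_swap {n} {N : nat -> int} {B j} {V : nmodType} (F : nat -> V)
    (l m : 'I_n.+1) : (j <= l)%N -> (j <= m)%N ->
  \sum_(f in partial_flows n N B j) F (inflow f l) =
  \sum_(f in partial_flows n N B j) F (inflow f m).
Proof.
move=> jl jm.
rewrite (reindex_inj (inv_inj (@swap_targetsK n B l m))).
by apply: eq_big => f; rewrite ?swap_partial_flows// inflow_swap tpermL.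
Qed.

(** The mean of the pending inflow at [j], with denominators cleared: by exchangeability all
    [n.+1 - j] pending vertices have the same sum. *)
Lemma sum_inflow {n} {N : nat -> int} {B} {j : 'I_n.+1} :
  (n.+1 - j)%N%:Z * (\sum_(f in partial_flows n N B j) (inflow f j)%:Z) =
  #|partial_flows n N B j|%:Z * \sum_(i < j) N i.
Proof.
have jn : (j <= n)%N by rewrite -ltnS.
transitivity (\sum_(l < n.+1 | (j <= l)%N)
    \sum_(f in partial_flows n N B j) (inflow f l)%:Z).
  under [RHS]eq_bigr => l jl do
    rewrite (sum_partial_flows_swap Posz l j jl (leqnn j)).
  rewrite sumr_const -mulr_natl natz; congr (_%:Z * _).
  rewrite -sum1_card.
  have -> : (\sum_(l < n.+1 | (j <= l)%N) 1)%N = (\sum_(j <= l < n.+1) 1)%N.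
    by rewrite (big_geq_mkord _ _ xpredT (fun=> 1%N)).
  by rewrite sum_nat_const_nat muln1.
rewrite exchange_big/= (eq_bigr (fun=> \sum_(i < j) N i)); last first.
  by move=> f fj; rewrite (sum_pending_inflow jn fj).
by rewrite sumr_const -mulr_natl natz.
Qed.

(** * Extending a partial flow by one vertex *)

(** Entry [i] of [t] goes to vertex [i + j.+1]. Entries are bounded by the emitted total [x], as in
    [card_ord_partitions]; the cast by [inord] is faithful once [x <= B]. *)
Definition emit {n B x k : nat} (j : 'I_n.+1)
    (f : flow n B) (t : k.-tuple 'I_x.+1) :
    flow n B :=
  [ffun p : 'I_n.+1 * 'I_n.+1 => if p.1 == j then
     if (j < p.2)%N then inord (nth ord0 t (p.2 - j.+1)) else ord0
   else f p].

Definition forget {n B : nat} (j : 'I_n.+1)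
    (f : flow n B) :
    flow n B :=
  [ffun p : 'I_n.+1 * 'I_n.+1 => if p.1 == j then ord0 else f p].

Lemma forget_emit {n} {N : nat -> int} {B x k} {j : 'I_n.+1} {f} {t : k.-tuple 'I_x.+1} :
  f \in partial_flows n N B j -> forget j (emit j f t) = f.
Proof.
move=> /partial_flowsP[f0 _]; apply/ffunP => -[i m]; rewrite !ffunE/=.
by case: eqP => // ->; apply/val_inj; rewrite /= f0 ?leqnn.
Qed.

Lemma emit_inj {n B x k} (j : 'I_n.+1) f : (x <= B)%N -> (k <= n - j)%N ->
  injective (@emit n B x k j f).
Proof.
move=> xB kn t u E; apply/val_inj; apply: (@eq_from_nth _ ord0).
  by rewrite !size_tuple.
rewrite size_tuple => i ik; apply/val_inj.
have jn := ltn_ord j.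
have mn : (i + j.+1 < n.+1)%N by lia.
move/ffunP: E => /(_ (j, Ordinal mn)); rewrite !ffunE/= eqxx.
have -> : (j < i + j.+1)%N by lia.
rewrite addnK => /(congr1 (@nat_of_ord _)).
have h (w : 'I_x.+1) : (w < B.+1)%N by apply: leq_trans (ltn_ord w) _.
by rewrite !inordK.
Qed.

Lemma outflow_emit {n B x k} (j : 'I_n.+1) f (t : k.-tuple 'I_x.+1) :
  (x <= B)%N -> k = (n - j)%N ->
  outflow (@emit n B x k j f t) j = (\sum_(i <- t) i)%N.
Proof.
move=> xB kn; pose F m := if (j < m)%N then nth ord0 t (m - j.+1) : nat else 0%N.
have -> : outflow (emit j f t) j = (\sum_(m < n.+1) F m)%N.
  apply: eq_bigr => m _; rewrite ffunE/= eqxx /F; case: ifP => //= _.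
  by rewrite inordK//; apply: leq_trans (ltn_ord _) _.
have jn : (j.+1 <= n.+1)%N by [].
rewrite -(big_mkord xpredT F) (@big_cat_nat _ _ _ j.+1)//=.
rewrite big_nat big1 ?add0n; last by move=> m /andP[_ mj]; rewrite /F ltnNge -ltnS mj.
rewrite -{1}(add0n j.+1) big_addn subSS -kn (big_nth ord0) size_tuple.
apply: eq_big_nat => i _; rewrite /F addnK.
by rewrite ifT//; lia.
Qed.

Lemma emit_partial_flows {n} {N : nat -> int} {B x k} {j : 'I_n.+1} {f} {t : k.-tuple 'I_x.+1} :
  (x <= B)%N -> k = (n - j)%N -> f \in partial_flows n N B j ->
  N j + (inflow f j)%:Z = x%:Z -> (\sum_(i <- t) i)%N = x ->
  emit j f t \in partial_flows n N B j.+1.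
Proof.
move=> xB kn /partial_flowsP[f0 fN] Nx tx; apply/partial_flowsP; split.
  move=> i m; rewrite ffunE/=; case: eqP => [->|/eqP/negbTE ij H].
    by rewrite ltnn/= leqNgt => /negbTE ->.
  apply: f0; move: ij H; rewrite -val_eqE/= => ij.
  by rewrite ltn_neqAle eq_sym ij.
have inE (l : 'I_n.+1) : (l <= j)%N -> inflow (emit j f t) l = inflow f l.
  move=> lj; apply: eq_bigr => i _; rewrite ffunE/=; case: eqP => // ->.
  by rewrite ltnNge lj/= f0 ?leqnn.
move=> i; rewrite ltnS => ij; rewrite inE//.
have [ijE|ij'] := eqVneq i j.
  rewrite ijE outflow_emit// tx -Nx; lia.
rewrite -fN; last by rewrite ltn_neqAle (inj_eq val_inj) ij'.
congr (_%:Z - _); apply: eq_bigr => m _.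
by rewrite ffunE/= (negbTE ij').
Qed.

(** The ways to send [z] units to [k.+1] targets, one more than the index; a negative amount cannot
    be sent. *)
Definition compositions (k : nat) (z : int) : nat :=
  if z is Posz x then 'C(x + k, k) else 0%N.

(** The longer partial flows are sorted by [forget j]; the fibre over [f] contains the injective
    image under [emit j f] of all tuples with the required sum. *)
Lemma card_partial_flowsS {n} {N : nat -> int} {B} {j : 'I_n.+1} :
  (j < n)%N -> \sum_(i < j.+1) N i <= B%:Z ->
  (\sum_(f in partial_flows n N B j)
     compositions (n - j.+1) (N j + (inflow f j)%:Z)
   <= #|partial_flows n N B j.+1|)%N.
Proof.
move=> jn sB; rewrite -sum1_card.
rewrite [leqRHS](partition_big (forget j) xpredT)//=.
rewrite [leqRHS](bigID (fun f => f \in partial_flows n N B j))/=.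
apply: leq_trans (leq_addr _ _); apply: leq_sum => f fj.
case E: (N j + _) => [x|]//=.
(* The inflow at [j] is at most the whole pending inflow, so the cap [B] excludes no tuple. *)
have xB : (x <= B)%N.
  rewrite -lez_nat -E; apply: le_trans sB.
  rewrite big_ord_recr/= [leRHS]addrC lerD2l.
  rewrite -(sum_pending_inflow (ltnW jn) fj) (bigD1 j)//= lerDl.
  by apply: sumr_ge0.
have kn : (n - j.+1).+1 = (n - j)%N by lia.
rewrite addnC -card_ord_partitions sum1_card.
rewrite -(card_imset _ (emit_inj j f xB (eq_leq kn))).
apply/subset_leq_card/fintype.subsetP => g /imsetP[t]; rewrite inE => /eqP tx ->.
rewrite unfold_in /= emit_partial_flows//=.
by rewrite (forget_emit fj).
Qed.

(** * Complete flows *)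

Lemma partial_flows_is_Kflow {n} {N : nat -> int} {B} {f : flow n B} :
  f \in partial_flows n N B n -> @is_Kflow n N B f.
Proof.
move=> fn; have /partial_flowsP[f0 fN] := fn.
have outE (i : 'I_n.+1) : (\sum_(j : 'I_n.+1 | (i < j)%N) val (f (i, j)))%N
    = outflow f i.
  rewrite /outflow [RHS](bigID (fun j : 'I_n.+1 => (i < j)%N))/=.
  rewrite [X in (_ + X)%N]big1 ?addn0// => j; rewrite -leqNgt => ji.
  by rewrite f0 ?ji ?orbT.
have inE (i : 'I_n.+1) : (\sum_(k : 'I_n.+1 | (k < i)%N) val (f (k, i)))%N
    = inflow f i.
  rewrite /inflow [RHS](bigID (fun j : 'I_n.+1 => (j < i)%N))/=.
  rewrite [X in (_ + X)%N]big1 ?addn0// => j; rewrite -leqNgt => ji.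
  by rewrite f0 ?ji ?orbT.
apply/andP; split.
  by apply/forallP => -[i j]; apply/implyP => /= ji; rewrite f0 ?ji ?orbT.
apply/forallP => i; rewrite outE inE /Nvec; apply/eqP.
case: ltnP => [/fN//|ni].
have {ni} -> : i = ord_max by apply/val_inj/eqP; rewrite /= eqn_leq ni -ltnS ltn_ord.
have -> : outflow f ord_max = 0%N.
  by rewrite /outflow big1// => m _; rewrite f0//= leqnn.
rewrite -(sum_pending_inflow (leqnn n) fn) sub0r (big_pred1 ord_max)// => l.
by rewrite /= -val_eqE/= eqn_leq -(ltnS l) ltn_ord.
Qed.

Lemma card_partial_flows_le_Kost n (N : nat -> int) :
  (#|partial_flows n N (Kbound n N) n| <= Kost n N)%N.
Proof.
apply/subset_leq_card/fintype.subsetP => f /partial_flows_is_Kflow.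
by rewrite inE.
Qed.

Lemma spart_le_Kbound {n} {N : nat -> int} {k} : (k < n)%N -> spart N k <= (Kbound n N)%:Z.
Proof.
move=> kn; rewrite /spart /Kbound.
have -> : \sum_(j < k.+1) N j = \sum_(j < n.+1 | (j < k.+1)%N) Nvec n N j.
  rewrite (big_ord_widen n.+1 N); last by rewrite ltnS ltnW.
  by apply: eq_bigr => i ik; rewrite /Nvec (leq_trans ik).
rewrite -natz natr_sum [leRHS](bigID (fun j : 'I_n.+1 => (j < k.+1)%N))/=.
rewrite -[leLHS]addr0 lerD ?sumr_ge0// ler_sum// => i _.
by rewrite natz abszE ler_norm.
Qed.

(** * Jensen's inequality at each vertex *)

(** For negative [z] the line lies below its value at -1, which is at most [binpoly k.+1 (-1) = 0].
    With a single target there is no such root, hence the index [k.+1]. *)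
Lemma compositions_lower_tangent {R : realType} k {x : R} : 0 <= x ->
  exists D, forall z : int,
    binpoly k.+1 x + D * (z%:~R - x) <= (compositions k.+1 z)%:R.
Proof.
move=> x0; have [D D0 HD] := binpoly_lower_tangent k.+1 x0.
exists D => -[m|m] /=.
  by rewrite -binpoly_nat HD// (le_trans (lerN10 _)).
have := HD _ (lexx _); rewrite binpolyN1; apply: le_trans.
by rewrite lerD2l ler_wpM2l// lerD2r NegzE rmorphN lerN2 ler1n.
Qed.

Lemma card_partial_flowsS_ge {R : realType} {n} {N : nat -> int} {B}
    {j : 'I_n.+1} :
  (j.+1 < n)%N -> \sum_(i < j.+1) N i <= B%:Z ->
  let x : R := (N j)%:~R + (\sum_(i < j) N i)%:~R / (n.+1 - j)%N%:R in
  0 <= x ->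
  #|partial_flows n N B j|%:R * binpoly (n - j.+1) x
    <= #|partial_flows n N B j.+1|%:R.
Proof.
move=> jn sB x x0.
have := card_partial_flowsS (ltnW jn) sB; rewrite -(ler_nat R).
apply: le_trans; rewrite natr_sum.
have [k kE] : exists k, (n - j.+1)%N = k.+1 by exists (n - j.+2)%N; lia.
rewrite kE; have [D HD] := compositions_lower_tangent k x0.
apply: le_trans (ler_sum _ (fun f _ => HD _)).
rewrite big_split/= -mulr_sumr sumrB !sumr_const.
under eq_bigr do rewrite rmorphD/=.
rewrite big_split/= sumr_const -(mulr_natl (binpoly _ _)) -(mulr_natl (N j)%:~R)
  -(mulr_natl x).
have K0 : (n.+1 - j)%N%:R != 0 :> R by rewrite pnatr_eq0; lia.
have := congr1 (fun z : int => z%:~R : R) (@sum_inflow n N B j).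
rewrite !rmorphM/= rmorph_sum/= => /(canRL (mulKf K0)) ->.
rewrite /x; set p := #|_|%:R.
(* The linear terms cancel because [x] is the mean emission, by [sum_inflow]. *)
suff -> : p * (N j)%:~R + (n.+1 - j)%N%:R^-1 * (p * (\sum_(i < j) N i)%:~R) -
   p * ((N j)%:~R + (\sum_(i < j) N i)%:~R / (n.+1 - j)%N%:R) = 0.
  by rewrite mulr0 addr0.
by ring.
Qed.

(* The pending inflows at the last two vertices are equidistributed and add up
   to [\sum_(i < j) N i], so in at least half of the partial flows the one at
   [j] is at least [- N j]. *)
Lemma card_partial_flows_last {n} {N : nat -> int} {B} {j : 'I_n.+1} :
  j.+1 = n -> \sum_(i < j.+1) N i <= B%:Z ->
  0 <= \sum_(i < j) N i + N j *+ 2 ->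
  (#|partial_flows n N B j| <= 2 * #|partial_flows n N B j.+1|)%N.
Proof.
move=> jn sB pos.
have jn' : (j < n)%N by lia.
apply: leq_trans (leq_mul (leqnn 2) (card_partial_flowsS jn' sB)).
have -> : (n - j.+1)%N = 0%N by lia.
rewrite mul2n -addnn.
have E := @sum_partial_flows_swap n N B j nat (fun m => compositions 0 (N j + m%:Z)) j ord_max (leqnn _) (ltnW jn').
rewrite [X in (_ <= X + _)%N]E -big_split/= -sum1_card.
apply: leq_sum => f fj.
have := sum_pending_inflow (ltnW jn') fj.
rewrite (bigD1 j)//= (bigD1 ord_max)/=; last first.
  by rewrite ltnW//= -val_eqE/= gtn_eqF.
rewrite big1 => [S|l]; last first.
  rewrite -!val_eqE/= => /andP[/andP[jl lj] ln]; exfalso.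
  have := ltn_ord l; move: lj ln => /eqP lj /eqP ln; lia.
move: pos; rewrite -S.
case E1: (N j + (inflow f j)%:Z) => [a|a]; case E2: (N j + (inflow f ord_max)%:Z) => [b|b];
  rewrite /= ?bin0//; lia.
Qed.

Lemma zero_partial_flow n (N : nat -> int) B :
  [ffun=> ord0] \in partial_flows n N B 0.
Proof. by apply/partial_flowsP; split => // i m _; rewrite ffunE. Qed.

(** For [n = 1] the constant [1 / n ^ 2] leaves no room for losing a half, so this case is separate:
    the zero partial flow extends. *)
Lemma Kost_one_ge1 (N : nat -> int) : 0 <= N 0%N -> (1 <= Kost 1 N)%N.
Proof.
move=> N0; apply: leq_trans (card_partial_flows_le_Kost 1 N).
have sB : \sum_(i < (ord0 : 'I_2).+1) N i <= (Kbound 1 N)%:Z.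
  exact: (spart_le_Kbound (ltn0Sn 0)).
apply: (leq_trans _ (card_partial_flowsS (ltn0Sn 0 : (ord0 < 1)%N) sB)).
rewrite (bigD1 _ (zero_partial_flow 1 N _))/= ltn_addr//.
by move: N0; case: (N 0%N) => [a|a]//= _; rewrite /= bin0.
Qed.

Lemma cK_mean_emission {R : realType} {n} {N : nat -> int} {i} : (i < n)%N ->
  (n - i)%N%:R * cK R n N (n - i) =
  (N i)%:~R + (\sum_(l < i) N l)%:~R / (n.+1 - i)%N%:R.
Proof.
move=> lin; rewrite /cK /spart subKn ?(ltnW lin)// big_ord_recr/= rmorphD/=.
rewrite subSn ?(ltnW lin)// natrM -natr1.
have : 0 < (n - i)%N%:R :> R by rewrite ltr0n subn_gt0.
move: (n - i)%N%:R => K K0.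
by field; rewrite !gt_eqF// addr_gt0.
Qed.

(** * The product bound *)

Section LowerBound.
Context {R : realType} {n : nat} {N : nat -> int}.
Context (n_gt0 : (0 < n)%N).
Context (H1 : forall k : nat, (k < n)%N ->
  0 <= spart N k /\ - ((n - k)%N%:Z * N k) <= spart N k).

Let s i : R := (spart N i)%:~R.
Let c := cK R n N.

Lemma spart_ge0 {i} : (i < n)%N -> 0 <= s i.
Proof. by move=> /H1[si _]; rewrite ler0z. Qed.

Lemma spart_pred_ge0 {i} : (i < n)%N -> 0 <= \sum_(l < i) N l.
Proof.
case: i => [|i] lin; first by rewrite big_ord0.
by have [] := H1 _ (ltnW lin).
Qed.

Lemma cK_ge0 {i} : (i < n)%N -> 0 <= c (n - i).
Proof.
move=> lin; have [si Ni] := H1 _ lin.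
have K0 : 0 < (n - i)%N%:R :> R by rewrite ltr0n subn_gt0.
have K1 : 0 < (n - i).+1%:R :> R by [].
have -> : c (n - i) = ((spart N i)%:~R + (n - i)%N%:R * (N i)%:~R)
    / ((n - i)%N%:R * (n - i).+1%:R).
  by rewrite /c /cK subKn ?(ltnW lin)// natrM; field; rewrite !gt_eqF.
rewrite divr_ge0 ?mulr_ge0//.
by move: Ni; rewrite -subr_ge0 opprK -(ler0z R) rmorphD rmorphM.
Qed.

Lemma mean_emission_le {i} : (i < n)%N -> (n - i)%N%:R * c (n - i) <= s i.
Proof.
move=> lin; rewrite cK_mean_emission// /s /spart big_ord_recr/= rmorphD/= addrC lerD2r.
have s0 : 0 <= (\sum_(l < i) N l)%:~R :> R by rewrite ler0z spart_pred_ge0.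
by rewrite ler_pdivrMr ?ltr0n ?subn_gt0 ?ltnS ?(ltnW lin)// ler_peMr// ler1n subn_gt0 ltnS ltnW.
Qed.

Let E i : R :=
  expR ((n - i)%N%:R * geom_entropy (c (n - i)) - geom_entropy (s i)).

Lemma prod_le_card_partial_flows {j} : (j < n)%N ->
  \prod_(i < j) E i <= #|partial_flows n N (Kbound n N) j|%:R.
Proof.
elim: j => [|j IH] jn.
  by rewrite big_ord0 ler1n; apply/card_gt0P; exists [ffun=> ord0]; exact: zero_partial_flow.
have jn1 : (j < n.+1)%N by lia.
have jn' := ltnW jn.
have x0 : 0 <= (N j)%:~R + (\sum_(i < j) N i)%:~R / (n.+1 - j)%N%:R :> R.
  by rewrite -cK_mean_emission// mulr_ge0// cK_ge0.
have := @card_partial_flowsS_ge R n N (Kbound n N) (Ordinal jn1) jn (spart_le_Kbound jn') x0.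
apply: le_trans; rewrite big_ord_recr/=; apply: ler_pM.
- by apply: prodr_ge0 => i _; exact: expR_ge0.
- exact: expR_ge0.
- exact: IH.
apply: le_trans (binpoly_entropy x0); rewrite ler_expR.
rewrite -cK_mean_emission// (_ : (n - j.+1).+1 = (n - j)%N); last by lia.
rewrite [X in geom_entropy (X / _)]mulrC mulfK ?pnatr_eq0 -?lt0n ?subn_gt0//.
(* Here the mean emission is replaced by the larger [s j]. *)
rewrite lerD2l lerN2.
by apply: geom_entropy_mono; rewrite ?mean_emission_le// mulr_ge0// cK_ge0.
Qed.

Lemma Kost_ge_half : (1 < n)%N -> \prod_(i < n) E i / 2 <= (Kost n N)%:R.
Proof.
move=> n1; rewrite ler_pdivrMr//.
have [m mn] : exists m, n = m.+1 by exists n.-1; rewrite prednK.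
have mltn : (m < n)%N by rewrite mn.
have mltn1 : (m < n.+1)%N by lia.
have Em : E m <= 1.
  rewrite /E -[leRHS]expR0 ler_expR subr_le0.
  have := mean_emission_le mltn; have := cK_ge0 mltn.
  rewrite (_ : (n - m)%N = 1%N); last by lia.
  rewrite !mul1r => c0 cs; exact: geom_entropy_mono.
have : \prod_(i < n) E i <= \prod_(i < m) E i.
  rewrite mn big_ord_recr/= ler_piMr//.
  by apply: prodr_ge0 => i _; exact: expR_ge0.
move=> /le_trans; apply; apply: le_trans (prod_le_card_partial_flows mltn) _.
rewrite -natrM ler_nat.
have pos : 0 <= \sum_(i < m) N i + N m *+ 2.
  have [_] := H1 _ mltn; rewrite (_ : (n - m)%N = 1%N); last by lia.
  by rewrite /spart big_ord_recr/= -subr_ge0 opprK mul1r mulr2n addrA.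
have := @card_partial_flows_last n N _ (Ordinal mltn1) (esym mn) (spart_le_Kbound mltn) pos.
rewrite -mn => /leq_trans; apply.
by rewrite mulnC leq_mul2r card_partial_flows_le_Kost orbT.
Qed.

Lemma Kost_ge_prod : (\prod_(i < n) E i) / (n ^ 2)%N%:R <= (Kost n N)%:R.
Proof.
have P0 : 0 <= \prod_(i < n) E i by apply: prodr_ge0 => i _; exact: expR_ge0.
have [n1|n1] := ltnP 1 n.
  apply: le_trans (Kost_ge_half n1); apply: ler_wpM2l => //.
  rewrite lef_pV2 ?posrE ?ltr0n ?expn_gt0 ?n_gt0// ler_nat.
  by apply: leq_trans (leq_pexp2l n_gt0 (isT : 1 <= 2)%N); rewrite expn1.
have {}n1 : n = 1%N by lia.
have N0 : 0 <= N 0%N.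
  by have [] := H1 _ n_gt0; rewrite /spart big_ord_recl big_ord0 addr0.
have K1 : 1 <= (Kost n N)%:R :> R by rewrite ler1n n1 Kost_one_ge1.
apply: le_trans K1; rewrite n1 big_ord_recl big_ord0 mulr1 divr1 /E/= -[leRHS]expR0 ler_expR subr_le0.
have := mean_emission_le n_gt0; have := cK_ge0 n_gt0.
rewrite subn0 n1 !mul1r => c0 cs; exact: geom_entropy_mono.
Qed.

End LowerBound.

(** * Deriving the two inequalities *)

Lemma prod_entropy_split {R : realType} {n} {N : nat -> int} (a : nat -> nat) :
  (forall k : nat, (k < n)%N ->
    0 <= spart N k /\ - ((n - k)%N%:Z * N k) <= spart N k) ->
  let c := cK R n N in
  \prod_(1 <= k < n.+1) ((c k + 1) `^ (c k + 1) / c k `^ c k) ^+ a k =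
  \prod_(i < n) expR ((a (n - i)%N)%:R * geom_entropy (c (n - i)%N)).
Proof.
move=> H1 c; rewrite big_add1/= big_nat_rev/= big_mkord.
apply: eq_bigr => i _; rewrite add0n subnSK//.
by rewrite -expR_geom_entropy ?cK_ge0// expRM_natl.
Qed.

Lemma expR_geom_entropy_le {R : realType} {s : R} : 0 <= s ->
  expR (geom_entropy s) <= expR 1 * (s + 1).
Proof.
rewrite le_eqVlt => /predU1P[<-|s0].
  by rewrite /geom_entropy mul0r subr0 add0r ln1 mulr0 mulr1 ler_expR ler01.
have s10 : 0 < s + 1 by rewrite addr_gt0.
rewrite -[X in _ * X]lnK ?posrE// -expRD ler_expR /geom_entropy.
have : s * (ln (s + 1) - ln s) <= s * ((s + 1) / s - 1).
  by rewrite ler_pM2l// ln_ratio_le.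
have -> : s * ((s + 1) / s - 1) = 1 by field; rewrite gt_eqF.
lra.
Qed.

Lemma expR_geom_entropy_ge {R : realType} {c : R} : 0 <= c ->
  c + 1 <= expR (geom_entropy c).
Proof.
rewrite le_eqVlt => /predU1P[<-|c0].
  by rewrite /geom_entropy mul0r subr0 add0r ln1 !mulr0 expR0.
have c10 : 0 < c + 1 by rewrite addr_gt0.
rewrite -[leLHS]lnK ?posrE// ler_expR /geom_entropy.
have : 0 <= c * (ln (c + 1) - ln c).
  apply: mulr_ge0; first exact: ltW.
  by rewrite subr_ge0 ler_ln ?posrE// lerDl.
lra.
Qed.

Definition drop_factor (n i : nat) : nat :=
  if i == 0%N then n else ((n - i) * (n - i).+1)%N.

Lemma drop_factor_gt0 {n i} : (i < n)%N -> (0 < drop_factor n i)%N.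
Proof.
by rewrite /drop_factor; case: eqP => [->//|_ lin]; rewrite muln_gt0 subn_gt0 lin.
Qed.

Lemma prod_drop_factor {n} : (0 < n)%N ->
  (\prod_(i < n) drop_factor n i = n`! ^ 2)%N.
Proof.
case: n => // m _; rewrite big_ord_recl/=.
rewrite (eq_bigr (fun i : 'I_m => (m - i) * (m - i).+1)%N) => [|i _]; last first.
  by rewrite /drop_factor/= /bump subSS.
suff -> : (\prod_(i < m) ((m - i) * (m - i).+1) = m`! * m.+1`!)%N.
  by rewrite /drop_factor/= mulnA -factS.
elim: m => [|m IH]; first by rewrite big_ord0.
rewrite big_ord_recl/= subn0 (eq_bigr (fun i : 'I_m => (m - i) * (m - i).+1)%N).
  by rewrite IH !factS; lia.
by move=> i _; rewrite /bump subSS.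
Qed.

(** With [G = expR \o geom_entropy] and [d = drop_factor n i], the chain is [G s <= e (s + 1) <= e d
    (c + 1) <= e d G c]. *)
Lemma entropy_drop {R : realType} {n i} {N : nat -> int} :
  (forall k : nat, (k < n)%N ->
    0 <= spart N k /\ - ((n - k)%N%:Z * N k) <= spart N k) ->
  (forall k : nat, (k < n)%N ->
    (N k)%:~R >= 1 / (n - k)%N%:R - (n - k + 1)%N%:R :> R) ->
  (i < n)%N ->
  expR (geom_entropy (spart N i)%:~R) <=
    expR 1 * (drop_factor n i)%:R
    * expR (geom_entropy (cK R n N (n - i))).
Proof.
move=> H1 H2 lin.
have c0 := @cK_ge0 R n N H1 i lin.
have s0 := @spart_ge0 R n N H1 i lin.
apply: le_trans (expR_geom_entropy_le s0) _.
rewrite -mulrA ler_pM2l ?expR_gt0//.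
apply: le_trans (_ : _ * (cK R n N (n - i) + 1) <= _); last first.
  by apply: ler_wpM2l => //; exact: expR_geom_entropy_ge.
have K0 : 0 < (n - i)%N%:R :> R by rewrite ltr0n subn_gt0.
have := @cK_mean_emission R n N i lin.
rewrite /drop_factor; case: eqP => [i0|_].
  rewrite i0 subn0 big_ord0 mul0r addr0 => E.
  rewrite mulrDr E mulr1 /spart big_ord_recl big_ord0/= addr0 lerD2l ler1n.
  by lia.
move=> _; have := H2 _ lin; rewrite addn1 /cK subKn ?(ltnW lin)// !natrM -natr1.
move: K0; set K : R := (n - i)%N%:R => K0 HN.
have -> : K * (K + 1) * ((N i)%:~R / (K + 1) + (spart N i)%:~R / (K * (K + 1)) + 1)
   = K * (N i)%:~R + (spart N i)%:~R + K * (K + 1).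
  by field; rewrite !gt_eqF// addr_gt0.
(* Multiplied by [K], the lower bound on [N i] becomes [1 <= K * N i + K * (K + 1)], which is what
   remains to be shown. *)
have : K * (1 / K - (K + 1)) <= K * (N i)%:~R by rewrite ler_pM2l.
have -> : K * (1 / K - (K + 1)) = 1 - K * (K + 1) by field; rewrite gt_eqF.
lra.
Qed.

Theorem theorem5p5 (R : realType) (n : nat) (N : nat -> int) :
  (0 < n)%N ->
  let s := spart N in
  let c := cK R n N in
  let H1 := forall k : nat, (k < n)%N ->
              0 <= s k /\ - ((n - k)%N%:Z * N k) <= s k in
  (H1 ->
     (Kost n N)%:R >=
       1 / (n ^ 2)%N%:R
       * (\prod_(k < n) ((s k)%:~R `^ (s k)%:~R
                          / (1 + (s k)%:~R) `^ (1 + (s k)%:~R) : R))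
       * \prod_(1 <= k < n.+1)
           (((c k + 1) `^ (c k + 1) / (c k) `^ (c k)) ^+ k))
  /\
  (H1 ->
   (forall k : nat, (k < n)%N ->
      (N k)%:~R >= 1 / (n - k)%N%:R - (n - k + 1)%N%:R :> R) ->
     (Kost n N)%:R >=
       1 / ((n ^ 2)%N%:R * expR 1 ^+ n * ((n`!)%:R) ^+ 2)
       * \prod_(1 <= k < n.+1)
           (((c k + 1) `^ (c k + 1) / (c k) `^ (c k)) ^+ k.-1)).
Proof.
move=> n0 s c H; split=> [H1|H1 H2].
  have s0 (i : 'I_n) : 0 <= (spart N i)%:~R :> R by exact: spart_ge0 H1 _ _.
  have -> : \prod_(k < n) ((s k)%:~R `^ (s k)%:~R
        / (1 + (s k)%:~R) `^ (1 + (s k)%:~R) : R)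
      = \prod_(k < n) expR (- geom_entropy (s k)%:~R).
    apply: eq_bigr => i _; rewrite expRN expR_geom_entropy ?s0//.
    by rewrite invf_div (addrC 1).
  rewrite (prod_entropy_split id H1) -mulrA -big_split/= mulrC mul1r.
  under eq_bigr do rewrite -expRD addrC.
  exact: Kost_ge_prod.
apply: le_trans (Kost_ge_prod n0 H1).
rewrite (prod_entropy_split predn H1) -/c.
have -> : 1 / ((n ^ 2)%N%:R * expR 1 ^+ n * (n`!)%:R ^+ 2) =
    (\prod_(i < n) (expR 1 * (drop_factor n i)%:R)^-1) / (n ^ 2)%N%:R :> R.
  rewrite prodfV big_split/= prodr_const card_ord -natr_prod prod_drop_factor// !natrX div1r -invfM.
  by congr _^-1; ring.
rewrite mulrAC -big_split/=; apply: ler_wpM2r => //.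
apply: ler_prod => i _; rewrite mulr_ge0 ?expR_ge0 ?invr_ge0//=.
rewrite ler_pdivrMl ?mulr_gt0 ?expR_gt0 ?ltr0n ?drop_factor_gt0//.
have := @entropy_drop R n i N H1 H2 (ltn_ord i).
move=> drop.
(* One of the [k] copies of [G(c_k)] is split off to absorb [G(s_i)], leaving the exponent
   [k.-1]. *)
have -> : (n - i)%N%:R = (n - i).-1%:R + 1 :> R.
  by rewrite natr1 prednK// subn_gt0.
rewrite mulrDl mul1r -addrA expRD mulrCA ler_peMr ?expR_ge0//.
by rewrite expRD expRN mulrA ler_pdivlMr ?expR_gt0// mul1r.
Qed.
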